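(* Let $\frac mn$ be a positive irreducible fraction ($m,n$ positive integers) and let $t$ be a positive integer with $2\le t\le \frac mn<t+1$. Then every faithful decomposition of $\frac mn$ has length at least $t+2$. Moreover, there are infinitely many faithful decompositions of $\frac mn$ of length exactly $t+2$.
   Context: A (fraction) decomposition of a positive rational $\frac mn$ is an expression $\frac mn=\frac{a_1}{b_1}+\cdots+\frac{a_k}{b_k}$ where $a_1,\dots,a_k$ are positive integers (so each $\frac{a_i}{b_i}$ is a positive rational) and $b_1,\dots,b_k$ are pairwise distinct positive integers; $k$ is its length. For a positive irreducible fraction $u=\frac mn$, such a decomposition is called faithful if for all integers $x_1,\dots,x_k$ with $0\le x_i\le a_i$, the number $v=\sum_{i=1}^k \frac{x_i}{b_i}$ does not lie in $\frac1n\mathbb Z=\{\frac{c}{n}:c\in\mathbb Z\}$ unless $v=u$ or $v=0$. *)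

(* Defs.v *)
From mathcomp Require Import all_boot all_order all_algebra.
From mathcomp Require Import finmap.
From mathcomp Require Import boolp classical_sets functions cardinality.

Set Implicit Arguments.
Unset Strict Implicit.
Unset Printing Implicit Defensive.

Import Order.TTheory GRing.Theory Num.Theory.
Local Open Scope ring_scope.

(* A decomposition a_1/b_1 + ... + a_k/b_k is the finite set of the pairs
   (a_i, b_i).  The b_i being pairwise distinct, no pair is repeated, so that
   the length k is the cardinal of the set; the order of the terms is
   irrelevant. *)
Definition decomposition (u : rat) (D : {fset nat * nat}) : Prop :=
  [/\ forall p, p \in D -> (0 < p.1)%N /\ (0 < p.2)%N,
      {in D &, injective (fun p : nat * nat => p.2)} &
      u = \sum_(p <- D) (p.1%:R / p.2%:R)].

(* The denominator n matters, so the fraction is given by the pair (m, n),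
   meant to be in lowest terms. *)
Definition faithful_decomposition (m n : nat) (D : {fset nat * nat}) : Prop :=
  decomposition (m%:R / n%:R) D /\
  forall x : nat * nat -> nat,
    (forall p, p \in D -> (x p <= p.1)%N) ->
    let v : rat := \sum_(p <- D) ((x p)%:R / p.2%:R) in
    (exists c : int, v = c%:~R / n%:R) -> v = m%:R / n%:R \/ v = 0.

(* Main.v *)
Require Import Defs.
From mathcomp Require Import all_boot all_order all_algebra.
From mathcomp Require Import finmap.
From mathcomp Require Import boolp classical_sets functions cardinality.
From mathcomp Require Import zify ring lra.

(* Lower bound.  Taking x_i = b_i shows a_i < b_i, so the deficits
   d_i = 1 - a_i/b_i are positive, length at most t is impossible, and for
   length t + 1 >= 3 they sum to at most 1.  If g divides b_i and b_j,
   faithfulness leaves no room for s/g + (g-s)/g = 1, that is,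
   g (1 - d_i - d_j) < 1; likewise g (1 - d_i) < 1 if g divides b_i and n.
   Hence pairs with a common factor carry more than half of the total deficit.
   Since the sum is m/n, no b_i is coprime to n and all the other b_j, and the
   graph of non-coprime pairs is forced to be a star or, when t = 2 and n = 1, a
   triangle.  In a star with centre c two leaves i, j would satisfy
   d_j < 1/gcd(b_i, b_c) <= d_i and symmetrically.  In a triangle the three
   gcds would have to be 2, 3, 5, and then the deficits sum to at most 28/30.

   Infinitely many.  Write m/n = t + 1 - N/n and N/n = d/q + 1/(nq) with q
   arbitrarily large.  Expanding 1/(nq) as in Sylvester's sequence gives terms
   with denominators pairwise coprime and coprime to n, except for the last
   term, which is a unit fraction. *)

Set Implicit Arguments.
Unset Strict Implicit.
Unset Printing Implicit Defensive.

Import Order.TTheory GRing.Theory Num.Theory.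
Local Open Scope ring_scope.

(** * Integrality and coprimality preliminaries *)

(** By Bezout the gcd is an integer combination of [p] and [q]. Thus a denominator dividing both
    numbers divides their gcd. *)
Lemma int_mul_gcdn (x : rat) (p q : nat) :
  x * p%:R \is a Num.int -> x * q%:R \is a Num.int ->
  x * (gcdn p q)%:R \is a Num.int.
Proof.
have [->|p_gt0] := posnP p; first by rewrite gcd0n.
move=> xp xq; case: (egcdnP q p_gt0) => kp kq kE _.
suff -> : x * (gcdn p q)%:R = x * p%:R * kp%:R - x * q%:R * kq%:R.
  by apply: rpredB; apply: rpredM; rewrite ?natr_int.
move/(congr1 (fun k => k%:R : rat)): kE; rewrite natrD !natrM => kE.
have -> : (gcdn p q)%:R = kp%:R * p%:R - kq%:R * q%:R :> rat.
  by rewrite kE addrAC subrr add0r.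
by ring.
Qed.

Lemma int_gt0_ge1 (x : rat) : x \is a Num.int -> 0 < x -> 1 <= x.
Proof.
by move=> xZ x0; have := norm_intr_ge1 xZ (lt0r_neq0 x0); rewrite gtr0_norm.
Qed.

Lemma int_div_mul (a b L : nat) :
  (b %| L)%N -> (a%:R / b%:R : rat) * L%:R \is a Num.int.
Proof.
case/dvdnP=> k ->; rewrite natrM.
have [->|b_gt0] := posnP b; first by rewrite mulr0 mulr0 rpred0.
have b_neq0 : b%:R != 0 :> rat by rewrite pnatr_eq0 -lt0n.
have -> : (a%:R / b%:R : rat) * (k%:R * b%:R) = a%:R * k%:R by field.
by rewrite rpredM ?natr_int.
Qed.

Lemma exists_notin (I : finType) (s : seq I) :
  (size s < #|I|)%N -> exists i, i \notin s.
Proof.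
move=> lt_s; apply/existsP; rewrite -negb_forall; apply/forallP => sI.
have := card_size s; suff -> : #|s| = #|I| by lia.
by apply: eq_card => i; rewrite sI.
Qed.

Lemma coprime_big_prodr (J : eqType) (s : seq J) (P : pred J) (F : J -> nat)
    (q : nat) :
  (forall j, j \in s -> P j -> coprime q (F j)) ->
  coprime q (\prod_(j <- s | P j) F j).
Proof.
move=> co; rewrite big_seq_cond; elim/big_ind: _ => [|x y|j /andP[]].
- exact: coprimen1.
- by rewrite coprimeMr => -> ->.
- exact: co.
Qed.

(** Lets a gcd [g] be replaced by a small lower bound [k], whatever the sign of [x]. *)
Lemma mulr_nat_lt1_le (g : nat) (x : rat) (k : nat) :
  (0 < k)%N -> (k <= g)%N -> g%:R * x < 1 -> k%:R * x < 1.
Proof.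
move=> k_gt0; rewrite -(ler_nat rat) => le_kg gx.
have [x0|/ltW x0] := leP 0 x; first by apply: le_lt_trans gx; rewrite ler_wpM2r.
by apply: le_lt_trans ltr01; rewrite mulr_ge0_le0.
Qed.

Lemma not_coprime_gcdn_ge2 p q : (0 < p)%N -> ~~ coprime p q -> (2 <= gcdn p
  q)%N.
Proof.
move=> p_gt0; have : (0 < gcdn p q)%N by rewrite gcdn_gt0 p_gt0.
by rewrite /coprime; lia.
Qed.

Lemma dvdn_gcdn_gcdn (p q r : nat) :
  (gcdn (gcdn p q) (gcdn p r) %| gcdn q r)%N.
Proof.
rewrite dvdn_gcd (dvdn_trans (dvdn_gcdl _ _)) ?dvdn_gcdr //.
by rewrite (dvdn_trans (dvdn_gcdr _ _)) ?dvdn_gcdr.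
Qed.

(** * Numerical exclusion of the triangle *)

(** Here [x], [y], [z] stand for the three pairwise gcds of denominators and [d], [e], [f] for the
    opposite deficits. Since 1/x + 1/y + 1/z <= 1 except for (2,2,z) and (2,3,z) with z <= 5, only
    these cases call on divisibility and integrality. *)
Lemma no_sorted_triangle (x y z : nat) (d e f : rat) :
  (2 <= x)%N -> (x <= y)%N -> (y <= z)%N -> (gcdn y z %| x)%N ->
  (gcdn x z %| y)%N ->
  0 < d -> 0 < e -> 0 < f ->
  x%:R * d < 1 -> y%:R * e < 1 -> z%:R * f < 1 ->
  d * (lcmn y z)%:R \is a Num.int -> e * (lcmn x z)%:R \is a Num.int ->
  f * (lcmn x y)%:R \is a Num.int -> d + e + f < 1.
Proof.
move=> x2 xy yz gx gy d0 e0 f0 dx ey fz dZ eZ fZ.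
have [x3|x_lt3] := leqP 3 x.
  have := mulr_nat_lt1_le (ltn0Sn 2) x3 dx.
  have := mulr_nat_lt1_le (ltn0Sn 2) (leq_trans x3 xy) ey.
  have := mulr_nat_lt1_le (ltn0Sn 2) (leq_trans x3 (leq_trans xy yz)) fz.
  by lra.
have xE : x = 2%N by lia.
subst x; have [y4|y_lt4] := leqP 4 y.
  have := mulr_nat_lt1_le (ltn0Sn 3) y4 ey.
  have := mulr_nat_lt1_le (ltn0Sn 3) (leq_trans y4 yz) fz.
  by lra.
have [yE|yE] : y = 2%N \/ y = 3%N by lia.
  (* Here 2f would be a positive integer below 1. *)
  subst y; have := mulr_nat_lt1_le (ltn0Sn 1) yz fz.
  by have := int_gt0_ge1 fZ; rewrite -[lcmn 2 2]/2%N; lra.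
subst y; have [z6|z_lt6] := leqP 6 z.
  by have := mulr_nat_lt1_le (ltn0Sn 5) z6 fz; lra.
have [zE|[zE|zE]] : z = 3%N \/ z = 4%N \/ z = 5%N by lia.
(* For z = 3, gcd(3,3) does not divide 2; for z = 4, gcd(2,4) does not divide 3. *)
- by subst z.
- by subst z.
subst z; move: dZ eZ fZ.
rewrite -[lcmn 3 5]/15%N -[lcmn 2 5]/10%N -[lcmn 2 3]/6%N => dZ eZ fZ.
have int_le k (w : rat) : w \is a Num.int -> w < k%:R + 1 -> w <= k%:R.
  move=> wZ; rewrite leNgt => wk; apply/negP => kw.
  have := @int_gt0_ge1 (w - k%:R); rewrite rpredB ?natr_int //.
  by move=> /(_ isT); lra.
(* The integers 15d < 15/2, 10e < 10/3 and 6f < 6/5 are at most 7, 3 and 1. *)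
have := int_le 7%N _ dZ; have := int_le 3%N _ eZ; have := int_le 1%N _ fZ.
by lra.
Qed.

(** The hypotheses are symmetric under permuting the three pairs, so the gcds may be sorted. *)
Lemma no_triangle (x y z : nat) (d e f : rat) :
  (2 <= x)%N -> (2 <= y)%N -> (2 <= z)%N ->
  (gcdn y z %| x)%N -> (gcdn x z %| y)%N -> (gcdn x y %| z)%N ->
  0 < d -> 0 < e -> 0 < f ->
  x%:R * d < 1 -> y%:R * e < 1 -> z%:R * f < 1 ->
  d * (lcmn y z)%:R \is a Num.int -> e * (lcmn x z)%:R \is a Num.int ->
  f * (lcmn x y)%:R \is a Num.int -> d + e + f < 1.
Proof.
move=> x2 y2 z2 gx gy gz d0 e0 f0 dx ey fz dZ eZ fZ.
have [gx' gy' gz'] : [/\ gcdn z y %| x, gcdn z x %| y & gcdn y x %| z]%N.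
  by split; rewrite gcdnC.
have [dZ' eZ' fZ'] : [/\ d * (lcmn z y)%:R \is a Num.int,
    e * (lcmn z x)%:R \is a Num.int & f * (lcmn y x)%:R \is a Num.int].
  by split; rewrite lcmnC.
have S := no_sorted_triangle.
case: (leqP x y) => [xy|/ltnW xy]; case: (leqP y z) => [yz|/ltnW yz];
  case: (leqP x z) => [xz|/ltnW xz].
- exact: (S x y z).
- exact: (S x y z).
- by rewrite addrAC; exact: (S x z y).
- by suff: f + d + e < 1 by [lra]; exact: (S z x y).
- by suff: e + d + f < 1 by [lra]; exact: (S y x z).
- by suff: e + f + d < 1 by [lra]; exact: (S y z x).
- by suff: f + e + d < 1 by [lra]; exact: (S z y x).
- by suff: f + e + d < 1 by [lra]; exact: (S z y x).
Qed.

(** * Constraints imposed by faithfulness on a finite family *)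

Section FaithfulFamily.

Variables (I : finType) (a b : I -> nat) (m n : nat).
Hypotheses (n_gt0 : (0 < n)%N) (a_gt0 : forall i, (0 < a i)%N)
  (b_gt0 : forall i, (0 < b i)%N) (u_ge2 : (2 : rat) <= m%:R / n%:R)
  (sum_ab : \sum_i (a i)%:R / (b i)%:R = m%:R / n%:R :> rat)
  (faithful_ab : forall x : I -> nat, (forall i, (x i <= a i)%N) ->
     let v : rat := \sum_i (x i)%:R / (b i)%:R in
     (exists c : int, v = c%:~R / n%:R) -> v = m%:R / n%:R \/ v = 0).

Let bR_gt0 i : 0 < (b i)%:R :> rat. Proof. by rewrite ltr0n. Qed.
Let nR_gt0 : 0 < n%:R :> rat. Proof. by rewrite ltr0n. Qed.

(** A value in (0, 1] is neither 0 nor m/n >= 2. *)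
Lemma no_subsum_in_unit_interval (x : I -> nat) (c : nat) :
  (forall i, (x i <= a i)%N) ->
  \sum_i (x i)%:R / (b i)%:R = c%:R / n%:R :> rat ->
  0 < (c%:R / n%:R : rat) <= 1 -> False.
Proof.
move=> xa vE /andP[c0 c1].
have [] := faithful_ab xa; first by exists c%:Z.
  by rewrite vE => uE; move: u_ge2; rewrite -uE; lra.
by rewrite vE => cE; move: c0; rewrite cE ltxx.
Qed.

(** Otherwise [a i] is at least k = b_i/g, and the subsum k/b_i = 1/g lies both in Z/n and in (0,
    1]. The case g = 1 gives a_i < b_i. *)
Lemma faithful_gcdn_denom i (g : nat) : (g %| b i)%N -> (g %| n)%N ->
  g%:R * ((a i)%:R / (b i)%:R) < 1 :> rat.
Proof.
move=> /dvdnP[k kE] /dvdnP[l lE]; rewrite ltNge; apply/negP.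
rewrite mulrA ler_pdivlMr // mul1r -natrM ler_nat kE mulnC.
have g_gt0 : (0 < g)%N by move: n_gt0; rewrite lE muln_gt0 => /andP[].
have l_gt0 : (0 < l)%N by move: n_gt0; rewrite lE muln_gt0 => /andP[].
rewrite leq_pmul2l // => ka.
apply: (@no_subsum_in_unit_interval (fun j => if j == i then k else 0)%N l).
- by move=> j; case: eqP => // ->.
- rewrite (bigD1 i) //= eqxx big1 ?addr0; last by move=> j /negPf->;
    rewrite mul0r.
  have k_gt0 : (0 < k)%N by move: (b_gt0 i); rewrite kE muln_gt0 => /andP[].
  have [gR kR lR] : [/\ g%:R != 0 :> rat, k%:R != 0 :> rat & l%:R != 0 :> rat].
    by rewrite !pnatr_eq0 -!lt0n.
  by rewrite kE lE !natrM; field; rewrite gR kR lR.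
- by rewrite divr_gt0 ?ltr0n //= ler_pdivrMr // mul1r ler_nat lE leq_pmulr.
Qed.

Let d i : rat := 1 - (a i)%:R / (b i)%:R.

Lemma deficit_gt0 i : 0 < d i.
Proof. by have := faithful_gcdn_denom (dvd1n (b i)) (dvd1n n); rewrite /d;
  lra. Qed.

(** Otherwise a_i/b_i + a_j/b_j >= 1 + 1/g. Rounding a_i/b_i down to s/g leaves (g-s)/g <= a_j/b_j,
    so s/g + (g-s)/g = 1 is a forbidden subsum. *)
Lemma faithful_gcdn_pair i j : i != j ->
  (gcdn (b i) (b j))%:R * (1 - d i - d j) < 1.
Proof.
move=> ij; have ji : j != i by rewrite eq_sym.
set g := gcdn _ _; rewrite /d ltNge; apply/negP => h.
have /dvdnP[k kE] : (g %| b i)%N by exact: dvdn_gcdl.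
have /dvdnP[l lE] : (g %| b j)%N by exact: dvdn_gcdr.
have g_gt0 : (0 < g)%N by rewrite gcdn_gt0 b_gt0.
have gR : 0 < g%:R :> rat by rewrite ltr0n.
have k_gt0 : (0 < k)%N by move: (b_gt0 i); rewrite kE muln_gt0 => /andP[].
have l_gt0 : (0 < l)%N by move: (b_gt0 j); rewrite lE muln_gt0 => /andP[].
have ab_lt : (a i < b i)%N.
  by have := deficit_gt0 i; rewrite /d subr_gt0 ltr_pdivrMr // mul1r ltr_nat.
pose s := (g * a i %/ b i)%N.
have s_le : (s * k <= a i)%N.
  have := leq_divM (g * a i) (b i); rewrite -/s {1}kE mulnA [(_ * g)%N]mulnC.
  by rewrite leq_pmul2l.
have sg : (s <= g)%N.
  by rewrite -(leq_pmul2r k_gt0) mulnC [(g * _)%N]mulnC mulnC -kE ltnW //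
    (leq_ltn_trans s_le).
have s_gt : g%:R * ((a i)%:R / (b i)%:R) < s%:R + 1 :> rat.
  rewrite mulrA ltr_pdivrMr // natr1 -!natrM ltr_nat.
  exact: ltn_ceil.
have gs_le : ((g - s) * l <= a j)%N.
  have : (g%:R - s%:R : rat) <= g%:R * ((a j)%:R / (b j)%:R) by lra.
  rewrite -natrB // mulrA ler_pdivlMr // -!natrM ler_nat {1}lE mulnA [(_ *
    g)%N]mulnC.
  by rewrite leq_pmul2l.
apply: (@no_subsum_in_unit_interval
  (fun h => if h == i then s * k else if h == j then (g - s) * l else 0)%N n).
- by move=> h'; case: eqP => [->//|_]; case: eqP => [->//|_].
- rewrite (bigD1 i) //= eqxx (bigD1 j) //= eqxx (negPf ji) big1 ?addr0;
    last first.
    by move=> h' /andP[/negPf-> /negPf->]; rewrite mul0r.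
  rewrite divff ?lt0r_neq0 // kE lE !natrM natrB //.
  have [kR lR] : k%:R != 0 :> rat /\ l%:R != 0 :> rat.
    by rewrite !pnatr_eq0 -!lt0n.
  by field; rewrite kR lR lt0r_neq0.
- by rewrite divff ?lt0r_neq0 // ltr01 lexx.
Qed.

Lemma faithful_gcdn_total i : (gcdn (b i) n)%:R * (1 - d i) < 1.
Proof.
have := faithful_gcdn_denom (dvdn_gcdl (b i) n) (dvdn_gcdr (b i) n).
by rewrite /d subKr.
Qed.

(** The denominator of [d i] divides [b i]; writing a_i/b_i as m/n minus the other terms, it also
    divides [L]. *)
Lemma deficit_int i (L : nat) :
  (forall j, j != i -> b j %| L)%N -> (n %| L)%N ->
  d i * (gcdn (b i) L)%:R \is a Num.int.
Proof.
move=> bL nL; apply: int_mul_gcdn.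
  by rewrite mulrBl mul1r divfK ?lt0r_neq0 // rpredB ?natr_int.
rewrite /d; move: sum_ab; rewrite (bigD1 i) //= => /(canRL (addrK _)) ->.
rewrite mulrBl mul1r rpredB ?natr_int // mulrBl rpredB ?int_div_mul //.
by rewrite mulr_suml rpred_sum // => j ji; rewrite int_div_mul ?bL.
Qed.

Lemma dvdn_big_prod (P : pred I) j : P j -> (b j %| \prod_(h | P h) b h)%N.
Proof. by move=> Pj; rewrite (bigD1 j) //= dvdn_mulr. Qed.

(** Otherwise [deficit_int] makes [d i] a positive integer, although [d i] < 1. *)
Lemma exists_neighbour i : coprime (b i) n ->
  exists2 j, j != i & (2 <= gcdn (b i) (b j))%N.
Proof.
move=> bin; apply: contrapT => noj.
have co j : j != i -> coprime (b i) (b j).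
  move=> ji; have [g2|] := leqP 2 (gcdn (b i) (b j)); first by case: noj;
    exists j.
  have : (0 < gcdn (b i) (b j))%N by rewrite gcdn_gt0 b_gt0.
  by rewrite /coprime; lia.
have := @deficit_int i (n * \prod_(j | j != i) b j).
rewrite (_ : gcdn _ _ = 1%N) ?mulr1; last first.
  by apply/eqP;
    rewrite -/(coprime _ _) coprimeMr bin coprime_big_prodr // => j _;
      exact: co.
move=> dZ; have : 1 <= d i.
  apply: int_gt0_ge1 (deficit_gt0 i); apply: dZ; last exact: dvdn_mulr.
  by move=> j ji; rewrite dvdn_mull // dvdn_big_prod.
have : 0 < (a i)%:R / (b i)%:R :> rat by rewrite divr_gt0 ?ltr0n.
by rewrite /d; lra.
Qed.

(** Otherwise [n] is coprime to the product of all [b i], which also clears the denominator of m/n;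
    then m/n is an integer, against n > 1. *)
Lemma exists_common_denom : coprime m n -> (1 < n)%N ->
  exists i, (2 <= gcdn (b i) n)%N.
Proof.
move=> comn n_gt1; apply: contrapT => noi.
have co i : coprime n (b i).
  have [g2|] := leqP 2 (gcdn (b i) n); first by case: noi; exists i.
  have : (0 < gcdn (b i) n)%N by rewrite gcdn_gt0 b_gt0.
  by rewrite coprime_sym /coprime; lia.
pose B := (\prod_i b i)%N.
have coB : coprime n (m * B).
  by rewrite coprimeMr coprime_sym comn /=; apply: coprime_big_prodr.
have uB : (m%:R / n%:R : rat) * B%:R \is a Num.int.
  rewrite -sum_ab mulr_suml rpred_sum // => i _.
  by rewrite int_div_mul // (@dvdn_big_prod predT).
have un : (m%:R / n%:R : rat) * n%:R \is a Num.int by rewrite int_div_mul.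
have := int_mul_gcdn un uB;
  have /eqP -> : coprime n B by apply: coprime_big_prodr.
rewrite mulr1 => /intrP[c cE]; have : (n %| m)%N.
  have : m%:Z = c * n%:Z.
    apply/eqP; rewrite -(eqr_int rat) rmorphM /= -cE divfK //.
    exact: lt0r_neq0.
  by move=> mE; rewrite -[m]/`|m%:Z|%N mE abszM dvdn_mull.
by move=> nm; move: comn; rewrite /coprime (gcdn_idPr nm); lia.
Qed.

(** * Families of total deficit at most 1: stars and triangles *)

Hypothesis sum_d : \sum_i d i <= 1.

Lemma deficits_le1 (s : seq I) : uniq s -> \sum_(i <- s) d i <= 1.
Proof.
move=> us; apply: le_trans sum_d; rewrite big_uniq // [leRHS](bigID (mem s)) /=.
by rewrite lerDl sumr_ge0 // => i _; apply/ltW/deficit_gt0.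
Qed.

(** A leaf [i] shares factors only with the centre, so with g = gcd(b_i, b_c) the number g d_i is a
    positive integer. For another leaf [j], d_j <= 1 - d_i - d_c < 1/g <= d_i; exchanging the leaves
    gives a contradiction. *)
Lemma star_contra c : (3 <= #|I|)%N ->
  (forall i, i != c -> coprime (b i) n) ->
  (forall i j, i != c -> j != c -> i != j -> coprime (b i) (b j)) -> False.
Proof.
move=> I3 con cob.
have lt_d i j : i != c -> j != c -> i != j -> d j < d i.
  move=> ic jc ij.
  have dZ : d i * (gcdn (b i) (b c))%:R \is a Num.int.
    have := @deficit_int i (b c * (n * \prod_(h | (h != i) && (h != c)) b h)).
    (* The factors of the common multiple other than [b c] are coprime to [b i] and drop out of the
       gcd. *)
    rewrite Gauss_gcdl; last first.
      rewrite coprimeMr con // coprime_big_prodr // => h _ /andP[hi hc].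
      by rewrite cob // eq_sym.
    apply; last by rewrite dvdn_mull // dvdn_mulr.
    move=> h hi; have [->|hc] := eqVneq h c; first exact: dvdn_mulr.
    by rewrite dvdn_mull // dvdn_mull // dvdn_big_prod ?hi.
  have g_gt0 : 0 < (gcdn (b i) (b c))%:R :> rat by rewrite ltr0n gcdn_gt0 b_gt0.
  have := int_gt0_ge1 dZ (mulr_gt0 (deficit_gt0 i) g_gt0).
  have := faithful_gcdn_pair ic.
  have : \sum_(h <- [:: i; c; j]) d h <= 1.
    by apply: deficits_le1; rewrite /= !inE negb_or ic ij eq_sym jc.
  rewrite !big_cons big_nil; set g := (gcdn _ _)%:R in g_gt0 *.
  move=> s1 s2 s3; rewrite -(ltr_pM2l g_gt0).
  apply: le_lt_trans (lt_le_trans s2 _); last by rewrite mulrC.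
  by rewrite ler_pM2l //; lra.
have [i] : exists i, i \notin [:: c] by apply: exists_notin;
  apply: leq_trans I3.
rewrite !inE => ic.
have [j] : exists j, j \notin [:: c; i] by apply: exists_notin;
  apply: leq_trans I3.
rewrite !inE negb_or => /andP[jc ji].
have := lt_d i j ic jc; rewrite eq_sym => /(_ ji) ij.
by have := lt_trans ij (lt_d _ _ jc ic ji); rewrite ltxx.
Qed.

Lemma pair_deficit_gt_half i j : i != j -> ~~ coprime (b i) (b j) ->
  1 / 2%:R < d i + d j.
Proof.
move=> ij /(not_coprime_gcdn_ge2 (b_gt0 i)) g2.
by have := mulr_nat_lt1_le (ltn0Sn 1) g2 (faithful_gcdn_pair ij); lra.
Qed.

Lemma denom_deficit_gt_half i : ~~ coprime (b i) n -> 1 / 2%:R < d i.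
Proof.
move=> /(not_coprime_gcdn_ge2 (b_gt0 i)) g2.
by have := mulr_nat_lt1_le (ltn0Sn 1) g2 (faithful_gcdn_total i); lra.
Qed.

(** A term [c] meeting [n] takes more than half of the deficit. This leaves no room for a second
    such term or for a non-coprime pair avoiding [c], so [c] is the centre of a star. *)
Lemma fractional_contra : (3 <= #|I|)%N -> coprime m n -> (1 < n)%N -> False.
Proof.
move=> I3 comn n_gt1; have [c gc] := exists_common_denom comn n_gt1.
have dc : 1 / 2%:R < d c.
  by apply: denom_deficit_gt_half; rewrite /coprime; lia.
apply: (star_contra I3 (c := c)).
  move=> i ic; apply/negPn/negP => /denom_deficit_gt_half di.
  have : \sum_(h <- [:: i; c]) d h <= 1.
    by apply: deficits_le1; rewrite /= !inE ic.
  by rewrite !big_cons big_nil; lra.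
move=> i j ic jc ij; apply/negPn/negP => /(pair_deficit_gt_half ij) dij.
have : \sum_(h <- [:: i; j; c]) d h <= 1.
  by apply: deficits_le1; rewrite /= !inE negb_or ij ic jc.
by rewrite !big_cons big_nil; lra.
Qed.

Lemma integral_contra : (3 <= #|I|)%N -> n = 1%N -> \sum_i d i = 1 -> False.
Proof.
move=> I3 n1 sum1; have con i : coprime (b i) n by rewrite n1 coprimen1.
have [i0 _] : exists i, i \notin ([::] : seq I).
  by apply: exists_notin; apply: leq_trans I3.
 case: (leqP 4 #|I|) => [I4|I_lt4].
  (* For a non-coprime pair [i], [j] avoiding [c], a fourth index [l] has a neighbour [s], and
     maximality gives d_l + d_c >= d_l + d_s > 1/2: the four deficits exceed 1. *)
  pose c := [arg max_(i > i0) d i]%O.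
  have dc i : d i <= d c by rewrite /c; case: arg_maxP => // k _; apply.
  apply: (star_contra I3 (c := c)) => // i j ic jc ij.
  apply/negPn/negP => /(pair_deficit_gt_half ij) dij.
  have [l] : exists l, l \notin [:: c; i; j] by apply: exists_notin;
    apply: leq_trans I4.
  rewrite !inE !negb_or => /and3P[lc li lj].
  have [s sl gls] := exists_neighbour (con l).
  have : 1 / 2%:R < d l + d s.
    by apply: pair_deficit_gt_half; rewrite 1?eq_sym // /coprime; lia.
  have : \sum_(h <- [:: l; c; i; j]) d h <= 1.
    apply: deficits_le1; rewrite /= !inE !negb_or lc li lj ij.
    by rewrite ![c == _]eq_sym ic jc.
  by rewrite !big_cons big_nil; have := dc s; lra.
have [j] : exists j, j \notin [:: i0] by apply: exists_notin;
  apply: leq_trans I3.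
rewrite !inE => j_i.
have [l] : exists l, l \notin [:: i0; j] by apply: exists_notin;
  apply: leq_trans I3.
rewrite !inE negb_or => /andP[l_i l_j].
have us : uniq [:: i0; j; l].
  by rewrite -rev_uniq /rev /= !inE negb_or l_j l_i j_i.
have allI h : h \in [:: i0; j; l].
  apply/negPn/negP => hn.
  have us4 : uniq (h :: [:: i0; j; l]) by rewrite cons_uniq hn us.
  have := max_card (mem (h :: [:: i0; j; l])); rewrite (card_uniqP us4) => le4.
  by have := leq_ltn_trans le4 I_lt4.
have sum3 : d i0 + d j + d l = 1.
  rewrite -sum1 (eq_bigl (fun h => h \in [:: i0; j; l])) => [|h]; last first.
    by rewrite allI.
  by rewrite -big_uniq //= !big_cons big_nil addr0 addrA.
(* With three indices, a coprime pair would make the third index the centre of a star. *)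
have star c p q : p != c -> q != c -> p != q ->
    (forall h, h \in [:: c; p; q]) -> (2 <= gcdn (b p) (b q))%N.
  move=> pc qc pq hI; apply: not_coprime_gcdn_ge2 => //.
  apply/negP => copq; apply: (star_contra I3 (c := c)) => // h k.
  have := hI h; rewrite !inE => /or3P[]/eqP->; rewrite ?eqxx //;
  have := hI k; rewrite !inE => /or3P[]/eqP->; rewrite ?eqxx //.
  by rewrite coprime_sym.
have g1 : (2 <= gcdn (b j) (b l))%N.
  by apply: (star i0); rewrite // eq_sym.
have g2 : (2 <= gcdn (b i0) (b l))%N.
  apply: (star j); rewrite // 1?eq_sym // => h.
  by have := allI h; rewrite !inE orbCA.
have g3 : (2 <= gcdn (b i0) (b j))%N.
  apply: (star l); rewrite // 1?eq_sym // => h.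
  by have := allI h; rewrite !inE; case: (h == i0); case: (h == j);
    case: (h == l).
have dint p q r : (forall h, h \in [:: p; q; r]) ->
    d p * (lcmn (gcdn (b p) (b q)) (gcdn (b p) (b r)))%:R \is a Num.int.
  move=> hI; have := @deficit_int p (lcmn (b q) (b r)).
  have -> : gcdn (b p) (lcmn (b q) (b r)) =
      lcmn (gcdn (b p) (b q)) (gcdn (b p) (b r)).
    (* Distributivity of gcd over lcm, read in the divisibility lattice. *)
    exact: (@meetUr _ natdvd (b p) (b q) (b r)).
  apply; last by rewrite n1 dvd1n.
  move=> h hp; have := hI h; rewrite !inE (negPf hp) /= => /orP[]/eqP->.
    exact: dvdn_lcml.
  exact: dvdn_lcmr.
(* As the three deficits sum to 1, the slack 1 - d_p - d_q is the third one. *)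
have pair p q r : p != q -> 1 - d p - d q = d r ->
    (gcdn (b p) (b q))%:R * d r < 1.
  by move=> pq <-; apply: faithful_gcdn_pair.
have allI' p q r : perm_eq [:: p; q; r] [:: i0; j; l] ->
    forall h, h \in [:: p; q; r].
  by move=> /perm_mem E h; rewrite E.
suff : d i0 + d j + d l < 1 by rewrite sum3 ltxx.
apply: (no_triangle (x := gcdn (b j) (b l)) (y := gcdn (b i0) (b l))
   (z := gcdn (b i0) (b j))) => //; try exact: deficit_gt0.
- by rewrite gcdnC dvdn_gcdn_gcdn.
- by rewrite gcdnC [gcdn (b i0) (b j)]gcdnC dvdn_gcdn_gcdn.
- rewrite gcdnC [gcdn (b j) (b l)]gcdnC [gcdn (b i0) (b l)]gcdnC.
  exact: dvdn_gcdn_gcdn.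
- by apply: pair; [rewrite eq_sym | lra].
- by apply: pair; [rewrite eq_sym | lra].
- by apply: pair; [rewrite eq_sym | lra].
- by rewrite lcmnC; apply: dint.
- rewrite lcmnC [gcdn (b i0) (b j)]gcdnC; apply: dint; apply: allI'.
  by apply/permP => P /=; rewrite addnCA.
- rewrite lcmnC [gcdn (b j) (b l)]gcdnC [gcdn (b i0) (b l)]gcdnC.
  by apply: dint; apply: allI'; apply/permP => P /=; lia.
Qed.

End FaithfulFamily.

(** * The lower bound on the length *)

Lemma faithful_length_ge (m n t : nat) (D : {fset nat * nat}) :
  (0 < n)%N -> coprime m n -> (2 <= t)%N ->
  (t%:R : rat) <= m%:R / n%:R -> (m%:R / n%:R : rat) < t%:R + 1 ->
  faithful_decomposition m n D -> (t + 2 <= #|` D|)%N.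
Proof.
move=> n_gt0 comn t_ge2 t_le lt_t1 [[pos _ uE] faith].
pose a (i : D) := (val i).1; pose b (i : D) := (val i).2.
have a_gt0 i : (0 < a i)%N by have [] := pos (val i) (valP i).
have b_gt0 i : (0 < b i)%N by have [] := pos (val i) (valP i).
have u_ge2 : (2 : rat) <= m%:R / n%:R.
  by apply: le_trans t_le; rewrite ler_nat.
have sum_ab : \sum_i (a i)%:R / (b i)%:R = m%:R / n%:R :> rat.
  by rewrite uE big_seq_fsetE.
have faith_ab (x : D -> nat) : (forall i, (x i <= a i)%N) ->
    let v : rat := \sum_i (x i)%:R / (b i)%:R in
    (exists c : int, v = c%:~R / n%:R) -> v = m%:R / n%:R \/ v = 0.
  (* Off [D] the default value is 0; the sums range over [D] only. *)
  move=> xa; pose y p := if insub p is Some i then x i else 0%N.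
  have yE : \sum_(p <- D) (y p)%:R / p.2%:R = \sum_i (x i)%:R / (b i)%:R :> rat.
    by rewrite big_seq_fsetE /=; apply: eq_bigr => i _; rewrite /y valK.
  rewrite -yE; apply: faith => p pD.
  by rewrite /y insubT /=; have := xa [` pD]%fset; rewrite /a.
pose d i : rat := 1 - (a i)%:R / (b i)%:R.
have d_gt0 i : 0 < d i by exact: (@deficit_gt0 _ a b m n).
have sum_d : \sum_i d i = #|` D|%:R - m%:R / n%:R.
  by rewrite sumrB sum_ab sumr_const cardfE.
rewrite leqNgt; apply/negP => D_lt.
have [D_le|D_gt] := leqP #|` D| t.
  have [i] : exists i : D, i \notin [::].
    apply: (@exists_notin D [::]); rewrite /= -cardfE lt0n cardfs_eq0.
    by apply/eqP => D0; move: u_ge2; rewrite uE D0 big_seq_fset0 /=; lra.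
  (* With at most [t] terms the total deficit would be at most t - m/n <= 0. *)
  move=> _; have : 0 < \sum_i d i.
    by rewrite (bigD1 i) //= ltr_wpDr // sumr_ge0 // => j _; apply: ltW.
  by rewrite sum_d; move: D_le; rewrite -(ler_nat rat); lra.
have DE : #|` D| = t.+1 by lia.
have D3 : (3 <= #|{: D}|)%N by rewrite -cardfE DE.
have sum_le1 : \sum_i d i <= 1 by rewrite sum_d DE -natr1; lra.
have [n_gt1|n_le1] := ltnP 1 n.
  exact: (@fractional_contra _ a b m n).
have nE : n = 1%N by lia.
apply: (@integral_contra _ a b m n) => //.
apply: (etrans sum_d); rewrite DE; move: t_le lt_t1;
  rewrite nE divr1 natr1 ler_nat ltr_nat.
(* For n = 1 the bounds force m = t, so the deficits sum to exactly 1. *)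
rewrite ltnS => tm mt; have -> : m = t by apply/eqP; rewrite eqn_leq mt tm.
by rewrite -natr1 addrAC subrr add0r.
Qed.

(** * Faithfulness from pairwise coprime denominators *)

Definition coprime_denoms (T : seq (nat * nat)) :=
  pairwise (fun p q => coprime p.2 q.2) T.

(* Pairwise coprimality makes the fractional parts independent: none of the
   denominators can be compensated by the others or by n. *)
Lemma coprime_denoms_rigid (n : nat) (T : seq (nat * nat))
    (x : nat * nat -> nat) :
  coprime_denoms T -> (forall p, p \in T -> coprime p.2 n) ->
  (forall p, p \in T -> x p < p.2)%N ->
  (\sum_(p <- T) (x p)%:R / p.2%:R : rat) * n%:R \is a Num.int ->
  forall p, p \in T -> x p = 0%N.
Proof.
elim: T => [//|p T IH] /= /andP[/allP copT coT] con xlt.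
have p_gt0 : (0 < p.2)%N by apply: leq_ltn_trans (xlt p (mem_head _ _)).
rewrite big_cons; set S := \sum_(j <- T) _ => vZ.
have xp0 : x p = 0%N.
  (* Multiplying by [n * P], coprime to [p.2], clears every other denominator; hence x_p/p.2 is an
     integer in [0, 1). *)
  pose P := (\prod_(q <- T) q.2)%N.
  have SP : S * P%:R \is a Num.int.
    rewrite mulr_suml big_seq rpred_sum // => q qT; apply: int_div_mul.
    by rewrite /P (big_rem q) //= dvdn_mulr.
  have xnP : ((x p)%:R / p.2%:R : rat) * (n * P)%:R \is a Num.int.
    have -> : ((x p)%:R / p.2%:R : rat) * (n * P)%:R =
        (((x p)%:R / p.2%:R + S) * n%:R) * P%:R - S * P%:R * n%:R.
      by rewrite natrM; ring.
    by apply: rpredB; apply: rpredM; rewrite ?natr_int.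
  have := int_mul_gcdn (int_div_mul (x p) (dvdnn p.2)) xnP.
  have /eqP -> : coprime p.2 (n * P).
    by rewrite coprimeMr con ?mem_head // coprime_big_prodr // => q /copT.
  rewrite mulr1 => xZ; apply/eqP; rewrite eqn0Ngt; apply/negP => x_gt0.
  have := int_gt0_ge1 xZ; rewrite divr_gt0 ?ltr0n // => /(_ isT).
  by rewrite ler_pdivlMr ?ltr0n // mul1r ler_nat leqNgt xlt ?mem_head.
move=> q; rewrite inE => /orP[/eqP->//|]; apply: IH => // [r rT|r rT|].
- by rewrite con // inE rT orbT.
- by rewrite xlt // inE rT orbT.
- by move: vZ; rewrite xp0 mul0r add0r.
Qed.

Lemma uniq_denoms_inj (T : seq (nat * nat)) :
  uniq [seq p.2 | p <- T] -> {in T &, injective (fun p : nat * nat => p.2)}.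
Proof.
elim: T => [//|r T IH] /= /andP[rT uT] p q; rewrite !inE.
move=> /orP[/eqP->|pT] /orP[/eqP->|qT] // pq; last exact: IH.
- by move: rT; rewrite pq map_f.
- by move: rT; rewrite -pq map_f.
Qed.

(* A subsum either omits 1/e, or its complement does; as the total is in Z/n,
   rigidity of the remaining terms applies in both cases. *)
Lemma faithful_unit_term (m n e : nat) (T : seq (nat * nat)) :
  (0 < n)%N -> (0 < e)%N -> coprime_denoms T ->
  (forall p, p \in T -> [/\ 0 < p.1, p.1 < p.2, p.2 < e & coprime p.2 n])%N ->
  m%:R / n%:R = 1 / e%:R + \sum_(p <- T) p.1%:R / p.2%:R :> rat ->
  faithful_decomposition m n [fset p in (1%N, e) :: T]%fset /\
  #|` [fset p in (1%N, e) :: T]%fset| = (size T).+1.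
Proof.
move=> n_gt0 e_gt0 coT Tprop uE; set S := (1%N, e) :: T.
have uS : uniq [seq p.2 | p <- S].
  rewrite /S /=; apply/andP; split.
    by apply/mapP => -[p /Tprop[_ _ + _] eE]; rewrite -eE ltnn.
  rewrite uniq_pairwise pairwise_map.
  apply: (sub_in_pairwise (P := mem T)) coT; last by apply/allP => p.
  move=> p q /Tprop[p1 p2 _ _] _ /= copq; apply/eqP => pqE.
  (* Equal coprime denominators would be 1, against 0 < p.1 < p.2. *)
  by move: copq; rewrite -pqE /coprime gcdnn => /eqP p2E; move: p1 p2;
    rewrite p2E; lia.
have inD : [fset p in S]%fset =i S by move=> p; rewrite in_fset.
have DE : perm_eq [fset p in S]%fset S.
  by apply: uniq_perm; [exact: fset_uniq | exact: map_uniq uS |].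
have sumE (F : nat * nat -> rat) :
    \sum_(p <- [fset p in S]%fset) F p = F (1%N, e) + \sum_(p <- T) F p.
  by rewrite (perm_big _ DE) big_cons.
split; last by rewrite (perm_size DE).
have nn : n%:R != 0 :> rat by rewrite pnatr_eq0 -lt0n.
split; first split.
- move=> p; rewrite inD in_cons => /orP[/eqP->//|/Tprop[p1 p2 _ _]].
  by split=> //; apply: leq_ltn_trans p2.
- by move=> p q; rewrite !inD; apply: uniq_denoms_inj.
- by rewrite sumE uE.
move=> x xle v [c]; rewrite /v sumE /= => vE.
have xT p : p \in T -> (x p <= p.1)%N by move=> pT; apply: xle;
  rewrite inD in_cons pT orbT.
have con p : p \in T -> coprime p.2 n by case/Tprop.
have : (x (1%N, e) <= 1)%N by apply: (xle (1%N, e)); rewrite inD mem_head.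
case x1: (x (1%N, e)) => [|[|//]] _; rewrite x1 in vE *.
  right; move: vE; rewrite mul0r add0r => vE.
  rewrite big_seq big1 // => p pT.
  rewrite (coprime_denoms_rigid coT con (x := x)) ?mul0r //.
    by move=> q qT; case/Tprop: (qT) => _ q2 _ _; apply: leq_ltn_trans q2;
      apply: xT.
  by rewrite vE divfK // intr_int.
left; rewrite uE; congr (_ + _); rewrite !big_seq; apply: eq_bigr => p pT.
congr (_%:R / _); apply/eqP; rewrite eqn_leq xT // -subn_eq0.
rewrite (coprime_denoms_rigid coT con (x := fun p => p.1 - x p)%N) //.
  by move=> q qT; case/Tprop: (qT) => _ q2 _ _; apply: leq_ltn_trans q2;
    apply: leq_subr.
have -> : \sum_(q <- T) (q.1 - x q)%:R / q.2%:R = m%:R / n%:R - c%:~R / n%:R :>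
  rat.
  rewrite -vE uE opprD addrACA subrr add0r -sumrB !big_seq.
  by apply: eq_bigr => q qT; rewrite natrB ?xT // mulrBl.
by rewrite mulrBl !divfK // rpredB ?natr_int ?intr_int.
Qed.

(** * Sylvester-type expansions *)

(* Each step rests on 1/R = 1/(R+1) + 1/(R(R+1)), and the last one on
   1/R = 1/(R-1) - 1/(R(R-1)). *)
Fixpoint sylvester_terms (R j : nat) : seq (nat * nat) :=
  if j is j'.+1 then (R, R.+1) :: sylvester_terms (R * R.+1) j'
  else [:: (R.-2, R.-1)].

Fixpoint sylvester_end (R j : nat) : nat :=
  if j is j'.+1 then sylvester_end (R * R.+1) j' else (R * R.-1)%N.

Lemma size_sylvester_terms (R j : nat) : size (sylvester_terms R j) = j.+1.
Proof. by elim: j R => //= j IH R; rewrite IH. Qed.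

(** Coprimality to the current [R] is the invariant: after one step it concerns R(R+1), hence both
    the old [R] and the new denominator R+1. *)
Lemma sylvester_termsP (R j : nat) : (3 <= R)%N ->
  [/\ forall p, p \in sylvester_terms R j ->
        [/\ 0 < p.1, p.1 < p.2, p.2 < sylvester_end R j & coprime p.2 R]%N,
      coprime_denoms (sylvester_terms R j), (R < sylvester_end R j)%N &
      1 / (sylvester_end R j)%:R +
        \sum_(p <- sylvester_terms R j) p.1%:R / p.2%:R =
      j.+1%:R - 1 / R%:R :> rat].
Proof.
elim: j R => [|j IH] R R3 /=.
  have lt_end : (R < R * R.-1)%N by nia.
  split=> //.
    move=> p; rewrite inE => /eqP-> /=; split; try lia.
    by rewrite -{2}(@prednK R) ?coprimenS //; lia.
  rewrite big_seq1 /=; case: R R3 {lt_end} => [|[|R]] //= R3.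
  rewrite natrM -[R.+2%:R]natr1 -[R.+1%:R]natr1.
  have Rn : R%:R + 1 != 0 :> rat by rewrite natr1 pnatr_eq0.
  have Rn2 : R%:R + 1 + 1 != 0 :> rat by rewrite !natr1 pnatr_eq0.
  by field; rewrite Rn Rn2.
have R'3 : (3 <= R * R.+1)%N by nia.
have [pP co Re sE] := IH _ R'3.
have Re' : (R.+1 < sylvester_end (R * R.+1) j)%N by apply: leq_ltn_trans Re;
  nia.
split.
- move=> p; rewrite inE => /orP[/eqP->|/pP[p1 p2 p3]] /=.
    by split=> //; [lia | rewrite coprimeSn].
  by rewrite coprimeMr => /andP[].
- rewrite /coprime_denoms /= -/(coprime_denoms _) co andbT;
    apply/allP => p /pP[_ _ _].
  by rewrite coprimeMr coprime_sym => /andP[_]; rewrite coprime_sym.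
- exact: ltn_trans Re'.
rewrite big_cons addrCA sE natrM -[R.+1%:R]natr1 -[j.+2%:R]natr1 /=.
have Rn : R%:R != 0 :> rat by rewrite pnatr_eq0; lia.
have Rn2 : R%:R + 1 != 0 :> rat by rewrite !natr1 pnatr_eq0.
by field; rewrite Rn Rn2.
Qed.

(** * Infinitely many decompositions of length t + 2 *)

(** A Bezout pair is shifted by a multiple of (n, N) to make [q] large; d < q comes from N <= n. *)
Lemma exists_large_bezout (N n B : nat) : (0 < N)%N -> (N <= n)%N ->
  coprime N n ->
  exists q d : nat, [/\ (B < q)%N, (0 < d < q)%N & (q * N = 1 + n * d)%N].
Proof.
move=> N_gt0 Nn coN; case: (egcdnP n N_gt0) => kN kn.
rewrite (eqP coN) => kE _.
exists (kN + n * B.+1)%N, (kn + N * B.+1)%N.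
have qE : ((kN + n * B.+1) * N = 1 + n * (kn + N * B.+1))%N by nia.
have d_gt0 : (0 < kn + N * B.+1)%N by nia.
have qB : (B < kN + n * B.+1)%N by nia.
split=> //; rewrite d_gt0 /=.
set q := (_ + n * _)%N in qE *; set d := (kn + _)%N in qE *; nia.
Qed.

(** One has m/n = (q-d)/q + (t - 1/(nq)), and the bracket expands into [t] Sylvester terms and one
    unit fraction 1/e with e > nq. *)
Lemma exists_faithful (m n t B : nat) :
  (0 < n)%N -> coprime m n -> (2 <= t)%N ->
  (t%:R : rat) <= m%:R / n%:R -> (m%:R / n%:R : rat) < t%:R + 1 ->
  exists D : {fset nat * nat},
    [/\ faithful_decomposition m n D, #|` D| = (t + 2)%N &
        exists2 p, p \in D & (B < p.2)%N].
Proof.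
move=> n_gt0 comn t2; have nR : 0 < n%:R :> rat by rewrite ltr0n.
rewrite ler_pdivlMr // -natrM ler_nat ltr_pdivrMr // natr1 -natrM ltr_nat => tm
  mt.
pose N := (t.+1 * n - m)%N.
have NE : (N + m = t.+1 * n)%N by rewrite /N; lia.
have coN : coprime N n.
  rewrite /coprime -dvdn1 -(eqP comn) dvdn_gcd dvdn_gcdr andbT.
  by rewrite -(dvdn_addr m (dvdn_gcdl N n)) NE dvdn_mull ?dvdn_gcdr.
(* The margin 2 ensures nq >= 3, where the Sylvester expansion starts. *)
have [q [d [qB /andP[d_gt0 dq] qE]]] :
  exists q d : nat, [/\ (B + 2 < q)%N, (0 < d < q)%N & (q * N = 1 + n * d)%N].
  by apply: exists_large_bezout => //; rewrite /N; lia.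
have R3 : (3 <= n * q)%N by nia.
(* The parameter t - 1 yields [t] terms. *)
have [TP coT Re sE] := sylvester_termsP t.-1 R3.
set e := sylvester_end _ _ in TP Re sE;
  set T := sylvester_terms _ _ in TP coT sE.
have qe : (q < e)%N by apply: leq_ltn_trans Re; nia.
have qn : coprime q n.
  have : coprime (q * N) n by rewrite qE coprime_sym /coprime addnC mulnC
    gcdnMDl gcdn1.
  by rewrite coprimeMl => /andP[].
have [|||||] := @faithful_unit_term m n e ((q - d, q)%N :: T) => //.
- by lia.
- rewrite /coprime_denoms /= -/(coprime_denoms _) coT andbT.
  by apply/allP => p /TP[_ _ _]; rewrite coprimeMr coprime_sym => /andP[_];
    rewrite coprime_sym.
- move=> p; rewrite inE => /orP[/eqP->/=|/TP[p1 p2 p3]].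
    by split=> //; lia.
  by rewrite coprimeMr => /andP[].
- have tE : t.-1.+1 = t by lia.
  rewrite big_cons addrCA sE tE [(_, _).1]/= [(_, _).2]/= natrB;
    last exact: ltnW.
  have qR : q%:R != 0 :> rat by rewrite pnatr_eq0; lia.
  have dE : d%:R = (q%:R * (t.+1%:R * n%:R - m%:R) - 1) / n%:R :> rat.
    have NR : N%:R = t.+1%:R * n%:R - m%:R :> rat by rewrite -natrM -NE natrD
      addrK.
    by rewrite -NR -natrM qE natrD natrM addrC addKr mulrC mulKf ?lt0r_neq0.
  by rewrite dE natrM -natr1; field; rewrite qR lt0r_neq0.
move=> fD cD; exists [fset p in (1%N, e) :: (q - d, q)%N :: T]%fset; split=> //.
  by rewrite cD /= size_sylvester_terms; lia.
exists (1%N, e); first by rewrite in_fset mem_head.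
by rewrite /=; lia.
Qed.

Theorem theorem1p1 (m n t : nat) (m_gt0 : (0 < m)%N) (n_gt0 : (0 < n)%N)
    (comn : coprime m n) (t_ge2 : (2 <= t)%N)
    (t_le : (t%:R : rat) <= m%:R / n%:R)
    (lt_t1 : (m%:R / n%:R : rat) < t%:R + 1) :
  (forall D : {fset nat * nat},
      faithful_decomposition m n D -> (t + 2 <= #|` D|)%N) /\
  infinite_set
    [set D : {fset nat * nat} |
       faithful_decomposition m n D /\ #|` D|%fset = (t + 2)%N]%classic.
Proof.
split=> [D|]; first exact: faithful_length_ge.
move=> /finite_fsetP[X XE].
(* [B] bounds every denominator occurring in the supposedly finite set. *)
pose B := (\sum_(D <- X) \sum_(p <- D) p.2)%N.
have [D [fD cD [p pD Bp]]] := exists_faithful B n_gt0 comn t_ge2 t_le lt_t1.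
have DX : D \in X.
  suff : [set` X]%classic D by [].
  by rewrite -XE.
move: Bp; rewrite /B (big_rem D) //= (big_rem p) //=; lia.
Qed.
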